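(* Let $(\mathfrak{A},* )$ be a polarizable $*$-algebra. Then there is a finite polarizing subgroup $G\subset\Gamma(\mathfrak{A},* )$.
   Context: A $*$-algebra $(\mathfrak{A},* )$ is a finite-dimensional unital associative algebra over $\mathbb{R}$ equipped with an $\mathbb{R}$-linear map (involution) $\alpha\mapsto\alpha^*$ satisfying $(\alpha\beta)^*=\beta^*\alpha^*$ and $(\alpha^* )^*=\alpha$. It carries its natural topology as a finite-dimensional real vector space. Its unitary group is $\Gamma(\mathfrak{A},* )=\{u\in\mathfrak{A}: uu^*=1_{\mathfrak{A}}\}$. A closed subgroup $G\subset\Gamma(\mathfrak{A},* )$ generates $\mathfrak{A}$ if $\mathfrak{A}$ is the smallest $*$-subalgebra of $\mathfrak{A}$ containing $G$ (equivalently, $\mathrm{span}_{\mathbb{R}}G=\mathfrak{A}$). $(\mathfrak{A},* )$ is polarizable if $\Gamma(\mathfrak{A},* )$ is compact and generates $\mathfrak{A}$. A compact subgroup $G\subset\Gamma(\mathfrak{A},* )$ is polarizing if $G$ generates $\mathfrak{A}$ and $\int_G g\,dg=0$, the integral being with respect to the normalized Haar measure of $G$ (for finite $G$, this is $\frac{1}{|G|}\sum_{g\in G}g=0$). *)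

(* Defs.v *)
From HB Require Import structures.
From mathcomp Require Export all_boot all_order all_algebra falgebra.
From mathcomp Require Export all_classical all_reals all_analysis.
Export Order.TTheory GRing.Theory Num.Theory.
Export numFieldNormedType.Exports.

Import VectorInternalTheory.

Set Implicit Arguments.
Unset Strict Implicit.
Unset Printing Implicit Defensive.

Local Open Scope classical_set_scope.
Local Open Scope ring_scope.

(* A carries its natural topology through the coordinate isomorphism
   v2r : A -> 'rV[R]_(dim A); since all linear isomorphisms of 'rV[R]_n are
   homeomorphisms, the choice of coordinates is immaterial. *)
Definition natural_space (R : realType) (A : falgType R) : Type :=
  initial_topology (v2r : A -> 'rV[R]_(dim A)).

HB.instance Definition _ (R : realType) (A : falgType R) :=
  Topological.copy (natural_space A)
    (initial_topology (v2r : A -> 'rV[R]_(dim A))).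
HB.instance Definition _ (R : realType) (A : falgType R) :=
  isPointed.Build (natural_space A) (0 : A).

Definition borel_space (R : realType) (A : falgType R) :=
  g_sigma_algebraType (@open (natural_space A)).

Definition is_involution (R : realType) (A : falgType R) (star : A -> A) :=
  (forall a b, star (a * b) = star b * star a) /\
  (forall a, star (star a) = a).

Definition unitary_group (R : realType) (A : falgType R) (star : A -> A) :
  set A := [set u | u * star u = 1].

Definition is_subgroup (R : realType) (A : falgType R) (star : A -> A)
    (G : set A) :=
  [/\ G `<=` unitary_group star, G 1,
      forall g h, G g -> G h -> G (g * h) &
      forall g, G g -> G g^-1].

Definition is_star_subalgebra (R : realType) (A : falgType R) (star : A -> A)
    (B : {vspace A}) :=
  [/\ 1 \in B, forall a b, a \in B -> b \in B -> a * b \in B &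
      forall a, a \in B -> star a \in B].

(* A is the only, hence the smallest, *-subalgebra of A containing G. *)
Definition generates (R : realType) (A : falgType R) (star : A -> A)
    (G : set A) :=
  forall B : {vspace A}, is_star_subalgebra star B ->
    (forall g, G g -> g \in B) -> B = fullv.

Definition compact_in (R : realType) (A : falgType R) (G : set A) :=
  compact (G : set (natural_space A)).

Definition is_polarizable (R : realType) (A : falgType R) (star : A -> A) :=
  compact_in (unitary_group star) /\ generates star (unitary_group star).

(* The normalized Haar measure of G, seen as a Borel measure on A
   carried by G. *)
Definition is_haar (R : realType) (A : falgType R) (G : set A)
    (mu : probability (borel_space A) R) :=
  mu G = 1%E /\
  forall (g : A) (E : set (borel_space A)), G g -> measurable E ->
    mu ((fun x : A => g * x) @^-1` E) = mu E.

(* The A-valued integral of the inclusion of G, taken coordinatewise. *)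
Definition vector_mean (R : realType) (A : falgType R) (G : set A)
    (mu : probability (borel_space A) R) : A :=
  r2v (\row_i Rintegral mu G (fun x => v2r (x : A) 0 i)).

(* A compact group has exactly one normalized Haar measure. *)
Definition is_polarizing (R : realType) (A : falgType R) (star : A -> A)
    (G : set A) :=
  [/\ is_subgroup star G, compact_in G, generates star G &
      exists mu : probability (borel_space A) R,
        is_haar G mu /\ vector_mean G mu = 0].

(* Main.v *)
From HB Require Import structures.
Require Import Defs.
From mathcomp Require Import measurable_realfun complex ring.

Set Implicit Arguments.
Unset Strict Implicit.
Unset Printing Implicit Defensive.
Local Open Scope classical_set_scope.
Local Open Scope ring_scope.
Import VectorInternalTheory.

(** Any finite subgroup of the unitary group that contains [-1] and generates
    the algebra is polarizing: its Haar measure is normalized counting, and [g]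
    cancels [- g] in the mean ([finite_polarizing]).  So it is enough to find a
    finite generating group.

    A polarizable algebra is a product of matrix algebras over [R],
    [C] and [H] with conjugate transposition, and the monomial matrices with
    coefficients [+/- 1], [+/- i], [+/- j], [+/- k] do the job.  The proof builds
    such a group from the projections of the algebra.

    The only analytic input is that the involution is definite:
    [x^* x + y^* y = 0] implies [x = 0] ([polarizable_definite]).  The unitary
    group is bounded, so it preserves a positive definite form on the algebra
    ([invariant_form]), obtained as the unique minimiser of a uniformly convex
    invariant function.  Since unitaries span, the involution is the adjoint for
    that form.

    Definiteness gives the rest by algebra.  A maximal orthogonal family of
    projections [e_i] sums to [1] and consists of minimal ones
    ([minimal_decomposition]).  Self-adjoint elements of [e_i A e_i] are real
    multiples of [e_i] ([minimal_selfadjoint]), so that nonzero elements of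
    [e_i A e_j] are multiples of partial isometries ([scaled_partial_isometry])
    and [e_i A e_i] is spanned by a finite group generated by anticommuting
    square roots of [- e_i] ([minimal_unit_group]).  Transported by partial
    isometries, these groups form a finite groupoid whose elements span every
    [e_i A e_j] ([finite_groupoid_exists]).  The unitaries with all entries in
    this groupoid or zero are the required group
    ([finite_generating_group]). *)

(** * Invariant forms of bounded matrix groups *)

Section Frobenius.
Variable R : realType.

Definition frob2 m n (X : 'M[R]_(m, n)) : R := \sum_i \sum_j X i j ^+ 2.

Lemma frob2_ge0 m n (X : 'M[R]_(m, n)) : 0 <= frob2 X.
Proof. by apply: sumr_ge0 => i _; apply: sumr_ge0 => j _; exact: sqr_ge0. Qed.

Lemma frob2_entry m n (X : 'M[R]_(m, n)) i j : X i j ^+ 2 <= frob2 X.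
Proof.
rewrite /frob2 (bigD1 i) //= (bigD1 j) //= -addrA lerDl addr_ge0 //.
  by apply: sumr_ge0 => *; exact: sqr_ge0.
by apply: sumr_ge0 => *; apply: sumr_ge0 => *; exact: sqr_ge0.
Qed.

Lemma frob2_eq0 m n (X : 'M[R]_(m, n)) : frob2 X <= 0 -> X = 0.
Proof.
move=> X0; apply/matrixP => i j; rewrite mxE; apply/eqP.
by rewrite -sqrf_eq0 eq_le sqr_ge0 (le_trans (frob2_entry X i j) X0).
Qed.

Lemma frob2_tr m n (X : 'M[R]_(m, n)) : frob2 X^T = frob2 X.
Proof.
rewrite /frob2 exchange_big; apply: eq_bigr => i _.
by apply: eq_bigr => j _; rewrite mxE.
Qed.

Lemma cauchy_schwarz n (a b : 'I_n -> R) :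
  (\sum_i a i * b i) ^+ 2 <= (\sum_i a i ^+ 2) * (\sum_i b i ^+ 2).
Proof.
have : 0 <= \sum_i \sum_j (a i * b j - a j * b i) ^+ 2.
  by apply: sumr_ge0 => i _; apply: sumr_ge0 => j _; exact: sqr_ge0.
have -> : \sum_i \sum_j (a i * b j - a j * b i) ^+ 2 =
    2 * ((\sum_i a i ^+ 2) * (\sum_i b i ^+ 2) - (\sum_i a i * b i) ^+ 2).
  transitivity (\sum_i \sum_j (a i ^+ 2 * b j ^+ 2 + b i ^+ 2 * a j ^+ 2
      - 2 * (a i * b i) * (a j * b j))).
    by apply: eq_bigr => i _; apply: eq_bigr => j _; ring.
  under eq_bigr => i _ do rewrite sumrB big_split /= -!mulr_sumr.
  rewrite sumrB big_split /= -!mulr_suml -mulr_sumr.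
  by ring.
by rewrite pmulr_rge0 // subr_ge0.
Qed.

Lemma frob2_mul m n p (X : 'M[R]_(m, n)) (Y : 'M[R]_(n, p)) :
  frob2 (X *m Y) <= frob2 X * frob2 Y.
Proof.
rewrite {2 3}/frob2 mulr_suml; apply: ler_sum => i _.
rewrite exchange_big /= mulr_sumr; apply: ler_sum => j _.
by rewrite mxE; exact: cauchy_schwarz.
Qed.

(** The uniform convexity behind the fixed point below: the squared norm of a
    midpoint falls short of the average by a multiple of the squared distance. *)
Lemma frob2_parallelogram m n (X Y : 'M[R]_(m, n)) :
  frob2 (2^-1 *: (X + Y)) = 2^-1 * (frob2 X + frob2 Y) - 4^-1 * frob2 (X - Y).
Proof.
rewrite /frob2 -big_split mulr_sumr mulr_sumr -sumrB; apply: eq_bigr => i _.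
rewrite -big_split mulr_sumr mulr_sumr -sumrB; apply: eq_bigr => j _.
by rewrite !mxE /=; field.
Qed.

Definition mx_cvg m n (X : nat -> 'M[R]_(m, n)) (Y : 'M[R]_(m, n)) :=
  forall i j, X k i j @[k --> \oo] --> Y i j.

Lemma sum_cvg (I : finType) (f : I -> nat -> R) (l : I -> R) :
  (forall i, f i k @[k --> \oo] --> l i) ->
  \sum_i f i k @[k --> \oo] --> \sum_i l i.
Proof. by move=> fl; apply: cvg_big => //; exact: add_continuous. Qed.

Lemma mx_cvg_mull m n p (Z : 'M[R]_(p, m)) (X : nat -> 'M[R]_(m, n)) Y :
  mx_cvg X Y -> mx_cvg (fun k => Z *m X k) (Z *m Y).
Proof.
move=> XY i j; rewrite mxE; under eq_cvg do rewrite mxE.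
by apply: sum_cvg => l; apply: cvgM; [exact: cvg_cst | exact: XY].
Qed.

Lemma mx_cvg_mulr m n p (Z : 'M[R]_(n, p)) (X : nat -> 'M[R]_(m, n)) Y :
  mx_cvg X Y -> mx_cvg (fun k => X k *m Z) (Y *m Z).
Proof.
move=> XY i j; rewrite mxE; under eq_cvg do rewrite mxE.
by apply: sum_cvg => l; apply: cvgM; [exact: XY | exact: cvg_cst].
Qed.

Lemma frob2_cvg m n (X : nat -> 'M[R]_(m, n)) Y :
  mx_cvg X Y -> frob2 (X k) @[k --> \oo] --> frob2 Y.
Proof.
move=> XY; apply: sum_cvg => i; apply: sum_cvg => j.
by rewrite expr2; under eq_cvg do rewrite expr2; apply: cvgM; exact: XY.
Qed.

Lemma harmonic_bound_cvg (a : nat -> R) (C : R) :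
  (forall k l, (k <= l)%N -> (a k - a l) ^+ 2 <= C * k.+1%:R^-1) ->
  cvgn a.
Proof.
move=> aC; apply: cauchy_cvg; apply: cauchy_exP => e e0.
have C0 : 0 <= C.
  by have := le_trans (sqr_ge0 _) (aC 0%N 0%N isT); rewrite invr1 mulr1.
have [N Ne] : exists N : nat, C * N.+1%:R^-1 < e ^+ 2.
  exists (Num.bound (C / e ^+ 2)).
  rewrite ltr_pdivrMr // mulrC -ltr_pdivrMr ?exprn_gt0 //.
  apply: lt_trans (archi_boundP _) _; last by rewrite ltr_nat.
  by rewrite divr_ge0 // sqr_ge0.
exists (a N); exists N => // l /= Nl.
rewrite -ball_normE /= -ltr_sqr ?nnegrE ?normr_ge0 ?ltW // real_normK ?num_real //.
exact: le_lt_trans (aC _ _ Nl) Ne.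
Qed.

End Frobenius.

(** A bounded group [P] of matrices acts on Gram matrices by
    [S |-> r S r^T].  On the convex invariant set [K] below, the function
    [S |-> sup_r |r S r^T|^2] is invariant, because [P] is a group, and
    uniformly convex, because of the parallelogram identity and of the bound on
    [P].  Hence it has exactly one minimiser in [K], which [P] must fix. *)
Section InvariantForm.
Variables (R : realType) (n : nat) (P : set 'M[R]_n) (c : R).
Hypothesis P1 : P 1%:M.
Hypothesis PM : forall r s, P r -> P s -> P (r *m s).
Hypothesis PV : forall r, P r -> exists2 s, P s & s *m r = 1%:M.
Hypothesis Pc : forall r, P r -> frob2 r <= c.

Let form (S : 'M[R]_n) (x : 'rV[R]_n) : R := (x *m S *m x^T) 0 0.
Let act (r S : 'M[R]_n) := r *m S *m r^T.

Let actM r s S : act r (act s S) = act (r *m s) S.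
Proof. by rewrite /act trmx_mul !mulmxA. Qed.

Let act1 S : act 1%:M S = S.
Proof. by rewrite /act trmx1 mul1mx mulmx1. Qed.

Let frob2_act r S : P r -> frob2 (act r S) <= c ^+ 2 * frob2 S.
Proof.
move=> Pr; apply: (le_trans (frob2_mul _ _)); rewrite frob2_tr expr2 mulrC -mulrA.
apply: ler_pM; rewrite ?frob2_ge0 ?Pc //.
by apply: le_trans (frob2_mul _ _) _; rewrite ler_wpM2r ?frob2_ge0 ?Pc.
Qed.

Let frob2_act_ge r S : P r -> frob2 S <= c ^+ 2 * frob2 (act r S).
Proof.
move=> /[dup] Pr /PV [s Ps sr]; rewrite -{1}[S]act1 -sr -actM.
exact: frob2_act.
Qed.

(* Bounding the form below on the whole orbit of x makes K invariant, and
   forces its elements to be positive definite. *)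
Let K (S : 'M[R]_n) :=
  S^T = S /\ forall r x, P r -> frob2 (x *m r) <= form S x.

Let bounded_by (S : 'M[R]_n) (v : R) := forall r, P r -> frob2 (act r S) <= v.

Let K_act r S : P r -> K S -> K (act r S).
Proof.
move=> Pr [sS Sx]; split.
  by rewrite /act !trmx_mul trmxK sS mulmxA.
move=> s x Ps; have [r' Pr' r'r] := PV Pr.
have -> : form (act r S) x = form S (x *m r).
  by rewrite /form /act trmx_mul !mulmxA.
have rr' : r *m r' = 1%:M by apply: mulmx1C.
have -> : x *m s = x *m r *m (r' *m s) by rewrite mulmxA -(mulmxA x) rr' mulmx1.
by apply: Sx; exact: PM.
Qed.

Let K_mid S T : K S -> K T -> K (2^-1 *: (S + T)).
Proof.
move=> [sS Sx] [sT Tx]; split; first by rewrite linearZ linearD /= sS sT.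
move=> r x Pr.
have -> : form (2^-1 *: (S + T)) x = 2^-1 * (form S x + form T x).
  by rewrite /form -scalemxAr -scalemxAl mulmxDr mulmxDl !mxE.
by rewrite ler_pdivlMl // mulr_natl mulr2n lerD ?Sx ?Tx.
Qed.

Let K_start : K c%:M.
Proof.
split; first exact: tr_scalar_mx.
move=> r x Pr; have -> : form c%:M x = c * frob2 x.
  rewrite /form mul_mx_scalar -scalemxAl mxE; congr (_ * _).
  by rewrite mxE /frob2 big_ord1; apply: eq_bigr => i _; rewrite !mxE expr2.
apply: (le_trans (frob2_mul _ _)); rewrite mulrC.
by rewrite ler_wpM2r ?frob2_ge0 ?Pc.
Qed.

Let V := [set v : R | exists2 S, K S & bounded_by S v].
Let m := inf V.

Let V_lb : lbound V 0.
Proof. by move=> v [S _ /(_ _ P1)]; apply: le_trans; exact: frob2_ge0. Qed.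

Let V0 : V !=set0.
Proof.
exists (c ^+ 2 * frob2 (c%:M : 'M[R]_n)); exists c%:M; first exact: K_start.
by move=> r Pr; exact: frob2_act.
Qed.

Let m_le S v : K S -> bounded_by S v -> m <= v.
Proof. by move=> KS Sv; apply: ge_inf; [exists 0; exact: V_lb | exists S]. Qed.

(* Two points of K whose suprema are close to the infimum m are close to each
   other. *)
Let close S T v : K S -> K T -> bounded_by S v -> bounded_by T v ->
  frob2 (S - T) <= 4 * c ^+ 2 * (v - m).
Proof.
move=> KS KT Sv Tv.
have [c2|c2] := eqVneq (c ^+ 2) 0.
  by have := frob2_act_ge (S - T) P1; rewrite c2 mul0r mulr0 mul0r.
have c2p : 0 < c ^+ 2 by rewrite lt_neqAle eq_sym c2 sqr_ge0.
have : m <= v - 4^-1 * (frob2 (S - T) / c ^+ 2).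
  apply: (m_le (K_mid KS KT)) => r Pr.
  have -> : act r (2^-1 *: (S + T)) = 2^-1 *: (act r S + act r T).
    by rewrite /act -scalemxAr -scalemxAl mulmxDr mulmxDl.
  rewrite frob2_parallelogram; apply: lerB.
    by rewrite ler_pdivrMl // mulr_natl mulr2n lerD ?Sv ?Tv.
  rewrite ler_pM2l // ler_pdivrMr // mulrC.
  have -> : act r S - act r T = act r (S - T).
    by rewrite /act mulmxBr mulmxBl.
  exact: frob2_act_ge.
rewrite lerBrDr addrC -lerBrDr ler_pdivrMl // ler_pdivrMr // => h.
by apply: le_trans h _; rewrite le_eqVlt mulrAC eqxx.
Qed.

Let minimizer : exists2 S, K S & bounded_by S m.
Proof.
have /choice [S SP] : forall k : nat, exists S, K S /\ bounded_by S (m + k.+1%:R^-1).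
  move=> k; have [||v [S KS Sv] vm] := @inf_adherent _ V k.+1%:R^-1.
  - by rewrite invr_gt0.
  - by split=> //; exists 0; exact: V_lb.
  exists S; split=> // r /Sv h; exact: le_trans h (ltW vm).
have cl k l : (k <= l)%N -> frob2 (S k - S l) <= 4 * c ^+ 2 * k.+1%:R^-1.
  move=> kl; have [KSk Sk] := SP k; have [KSl Sl] := SP l.
  have := close KSk KSl Sk; rewrite addrAC subrr add0r; apply.
  move=> r Pr; apply: le_trans (Sl _ Pr) _.
  by rewrite lerD2l lef_pV2 ?posrE // ler_nat.
pose L : 'M[R]_n := \matrix_(i, j) limn (fun k => S k i j).
have SL : mx_cvg S L.
  move=> i j; rewrite mxE; apply: (@harmonic_bound_cvg _ _ (4 * c ^+ 2)) => k l kl.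
  apply: le_trans (cl _ _ kl); have := frob2_entry (S k - S l) i j.
  by rewrite !mxE.
exists L.
  split.
    apply/matrixP => i j; rewrite mxE.
    have Lij : S k j i @[k --> \oo] --> L i j.
      by under eq_cvg => k do rewrite -(SP k).1.1 mxE; exact: SL.
    exact: (cvg_unique _ (SL j i) Lij).
  move=> r x Pr.
  have fL : form (S k) x @[k --> \oo] --> form L x.
    by apply: mx_cvg_mulr; exact: mx_cvg_mull.
  by apply: cvgr_to_ge fL _; apply: nearW => k; apply: (SP k).1.2.
move=> r Pr.
have aL : frob2 (act r (S k)) @[k --> \oo] --> frob2 (act r L).
  by apply: frob2_cvg; apply: mx_cvg_mulr; exact: mx_cvg_mull.
apply: (ler_cvg_to aL (g := fun k => m + harmonic k)).
  by rewrite -[X in _ --> X]addr0; apply: cvgD; [exact: cvg_cst | exact: cvg_harmonic].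
by apply: nearW => k; apply: (SP k).2.
Qed.

Lemma invariant_form : exists S : 'M[R]_n,
  [/\ S^T = S, forall x : 'rV_n, frob2 x <= (x *m S *m x^T) 0 0 &
      forall r, P r -> r *m S *m r^T = S].
Proof.
have [S KS Sm] := minimizer; exists S; split.
- by case: KS.
- by move=> x; have [_ /(_ _ x P1)] := KS; rewrite mulmx1.
move=> r Pr; apply/eqP; rewrite -subr_eq0; apply/eqP/frob2_eq0.
have := @close (act r S) S m (K_act Pr KS) KS; rewrite subrr mulr0; apply=> //.
by move=> s Ps; rewrite actM; apply: Sm; exact: PM.
Qed.

End InvariantForm.

(** * Algebras with a definite involution *)

(** The divisor is the minimal polynomial over the reals of a complex root. *)
Lemma real_poly_factor (R : realType) (p : {poly R}) : (1 < size p)%N ->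
  exists q d : {poly R}, [/\ p = q * d, (size q < size p)%N &
    exists s t : R, d = 'X - s%:P \/ t != 0 /\ d = ('X - s%:P) ^+ 2 + (t ^+ 2)%:P].
Proof.
move=> sp.
pose f : {rmorphism R -> R[i]} := real_complex R.
have p0 : p != 0 by rewrite -size_poly_gt0 (ltn_trans _ sp).
have /closed_rootP [[s t]] : size (map_poly f p) != 1%N.
  by rewrite size_map_poly gtn_eqF.
rewrite rootE => /eqP rz.
pose d : {poly R} := if t == 0 then 'X - s%:P else ('X - s%:P) ^+ 2 + (t ^+ 2)%:P.
have dm : d \is monic.
  rewrite /d; case: eqP => _; first exact: monicXsubC.
  rewrite monicE lead_coefDl ?lead_coef_exp ?lead_coefXsubC ?expr1n //.
  by rewrite size_exp_XsubC ltnS (leq_trans (size_polyC_leq1 _)).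
have sd : (1 < size d)%N.
  rewrite /d; case: eqP => _; rewrite ?size_XsubC //.
  by rewrite size_polyDl ?size_exp_XsubC // ltnS (leq_trans (size_polyC_leq1 _)).
have d0 : d != 0 by rewrite monic_neq0.
have dz : (map_poly f d).[(s +i* t)%C] = 0.
  rewrite /d; case: eqP => [->|_].
    by rewrite rmorphB /= map_polyX map_polyC !hornerE subrr.
  rewrite rmorphD rmorphXn rmorphB /= map_polyX !map_polyC !hornerE /=.
  apply/eqP; rewrite eq_complex /=; apply/andP; split; apply/eqP.
    have re (x y : R) : (x - x) * (x - x) - (y - 0) * (y - 0) + y ^+ 2 = 0 by ring.
    exact: re.
  have im (x y : R) : (x - x) * (y - 0) + (y - 0) * (x - x) + 0 = 0 by ring.
  exact: im.
have pE : p = (p %/ d)%R * d.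
  suff r0 : (p %% d)%R = 0 by rewrite {1}(divp_eq p d) r0 addr0.
  have : (map_poly f (p %% d)%R).[(s +i* t)%C] = 0.
    have := rz; rewrite {1}(divp_eq p d) rmorphD rmorphM /= hornerD hornerM dz.
    by rewrite mulr0 add0r.
  have : (size (p %% d)%R < size d)%N by rewrite ltn_modp.
  move: ((p %% d)%R : {poly R}) => r; rewrite /d; case: (eqVneq t 0) => [t0|t0].
    rewrite size_XsubC ltnS => /size1_polyC ->.
    by rewrite map_polyC hornerC => /eqP; rewrite fmorph_eq0 => /eqP ->.
  rewrite size_polyDl ?size_exp_XsubC ?ltnS ?(leq_trans (size_polyC_leq1 _)) //.
  move=> sr.
  have rE : r = (r`_1)%:P * 'X + (r`_0)%:P.
    apply/polyP => i; rewrite coefD coefMX !coefC.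
    case: i => [|[|i]] /=; rewrite ?addr0 ?add0r //.
    by rewrite nth_default // (leq_trans sr).
  rewrite rE rmorphD rmorphM /= map_polyX !map_polyC !hornerE /= => /eqP.
  rewrite eq_complex /= => /andP [/eqP re /eqP im].
  have r1 : r`_1 = 0.
    have aux (x y z : R) : z != 0 -> x * z + 0 * y + 0 = 0 -> x = 0.
      by move=> z0 /eqP; rewrite mul0r !addr0 mulf_eq0 (negPf z0) orbF => /eqP.
    exact: aux t0 im.
  have aux (x y z : R) : 0 * x - 0 * y + z = 0 -> z = 0.
    by rewrite !mul0r subrr add0r.
  by move: re; rewrite r1 => /aux ->; rewrite polyC0 mul0r addr0.
exists (p %/ d)%R, d; split => //.
  by rewrite size_divp // ltn_subrL ltn_predRL sd (ltn_trans _ sp).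
exists s, t; rewrite /d; case: (eqVneq t 0) => t0; by [left|right].
Qed.

(** The structure theory uses only that the involution is definite:
    [x^* x + y^* y = 0] forces [x = 0]. *)
Section Algebra.
Variables (R : realType) (A : falgType R) (star : {linear A -> A}).
Hypothesis star_inv : is_involution star.
Hypothesis definite : forall x y : A, star x * x + star y * y = 0 -> x = 0.

Let starM a b : star (a * b) = star b * star a. Proof. by case: star_inv. Qed.
Let starK a : star (star a) = a. Proof. by case: star_inv. Qed.

Lemma star1 : star 1 = 1.
Proof. by rewrite -[LHS]mulr1 -[in X in _ * X](starK 1) -starM mulr1 starK. Qed.

Lemma definite1 x : star x * x = 0 -> x = 0.
Proof. by move=> xx; apply: (@definite x 0); rewrite xx mulr0 addr0. Qed.

Definition projection (e : A) := star e = e /\ e * e = e.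

Definition corner (e f a : A) := e * a = a /\ a * f = a.

Definition minimal (e : A) :=
  [/\ projection e, e != 0 &
      forall f, projection f -> e * f = f -> f != 0 -> f = e].

(** Families subject to a condition that implies linear independence have
    bounded length; maximal ones provide first the projections, then the
    imaginary units of a corner. *)
Lemma free_max (P : seq A -> Prop) (s0 : seq A) :
  P s0 -> (forall s, P s -> free s) ->
  exists2 s, P s & forall s', P s' -> (size s' <= size s)%N.
Proof.
move=> Ps0 Pf.
pose Q n := `[< exists2 s, P s & size s = n >].
have exQ : exists n, Q n by exists (size s0); apply/asboolP; exists s0.
have ubQ n : Q n -> (n <= dim A)%N.
  move=> /asboolP [s /Pf + <-]; rewrite /free => /eqP <-.
  by rewrite -dimvf dimvS ?subvf.
have [n /asboolP [s Ps sn] nmax] := ex_maxnP exQ ubQ.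
exists s => // s' Ps'; rewrite sn; apply: nmax; apply/asboolP; by exists s'.
Qed.

Lemma star_horner (h : A) q : star h = h -> star (horner_alg h q) = horner_alg h q.
Proof.
move=> sh; elim/poly_ind: q => [|q c IH]; first by rewrite !rmorph0 linear0.
rewrite rmorphD rmorphM /= horner_algX horner_algC linearD linearZ /= star1.
rewrite starM IH sh; congr (_ + _).
transitivity (horner_alg h ('X * q) : A); first by rewrite rmorphM /= horner_algX.
by rewrite mulrC rmorphM /= horner_algX.
Qed.

Lemma annihilating_poly (h : A) : exists2 p : {poly R}, p != 0 & horner_alg h p = 0.
Proof.
pose X : (dim A).+1.-tuple A := [tuple h ^+ i | i < (dim A).+1].
have nf : ~~ free X.
  rewrite /free size_tuple neq_ltn; apply/orP; left.
  by have := dimvS (subvf <<X>>%VS); rewrite dimvf.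
apply: contrapT => np; move/negP: nf; apply; apply/freeP => k k0 i.
have [//|ki] := eqVneq (k i) 0; case: np.
exists (\poly_(j < (dim A).+1) k (inord j)).
  apply: contraNneq ki => /(congr1 (fun p : {poly R} => p`_i)).
  by rewrite coef_poly ltn_ord inord_val coef0 => ->.
rewrite poly_def raddf_sum /= -[RHS]k0; apply: eq_bigr => j _.
rewrite linearZ /= rmorphXn /= horner_algX inord_val.
by rewrite mulr_algl (nth_map j) ?size_enum_ord // nth_ord_enum.
Qed.

Lemma comm_horner (h a : A) q : h * a = a * h ->
  horner_alg h q * a = a * horner_alg h q.
Proof.
move=> ha; elim/poly_ind: q => [|q c IH]; first by rewrite !rmorph0 mul0r mulr0.
rewrite rmorphD rmorphM /= horner_algX horner_algC mulrDl mulrDr.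
by rewrite -mulrA ha mulrA IH mulrA -scalerAl -scalerAr mul1r mulr1.
Qed.

(** A polynomial killing [h] on [e] has a real or a quadratic factor
    [(X - s)^2 + t^2].  The latter kills no nonzero [x] of the form [q(h) e]:
    multiplying [((h - s)^2 + t^2) x = 0] on the left by [x^*] exhibits
    [(h - s) x] and [t x] as a violation of definiteness. *)
Lemma eigenvector (h e : A) : star h = h -> star e = e -> h * e = e * h ->
  e != 0 -> exists s q, horner_alg h q * e != 0 /\
    h * (horner_alg h q * e) = s *: (horner_alg h q * e).
Proof.
move=> sh se he e0; have [p p0 ph] := annihilating_poly h.
have {ph} : horner_alg h p * e = 0 by rewrite ph mul0r.
elim: {p}(size p) {-2}p (leqnn (size p)) p0 => [|n IH] p.
  by rewrite leqn0 size_poly_eq0 => ->.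
move=> sp p0 pe; case: (ltnP 1 (size p)) => [p1|]; last first.
  move=> /size1_polyC pc; move: pe p0; rewrite pc horner_algC -scalerAl mul1r.
  by move/eqP; rewrite scaler_eq0 (negPf e0) orbF polyC_eq0 => ->.
have [q [d [pqd sq dE]]] := real_poly_factor p1.
have q0 : q != 0 by apply: contraNneq p0 => q0; rewrite pqd q0 mul0r.
have [qe|qe] := eqVneq (horner_alg h q * e) 0.
  by apply: IH qe => //; rewrite -ltnS (leq_trans sq).
have : horner_alg h d * (horner_alg h q * e) = 0.
  by rewrite mulrA -rmorphM mulrC -pqd.
case: dE => s [t [->|[t0 ->]]].
  rewrite rmorphB /= horner_algX horner_algC mulrBl -scalerAl mul1r => /eqP.
  by rewrite subr_eq0 => /eqP hs; exists s, q.
rewrite rmorphD rmorphXn rmorphB /= horner_algX !horner_algC.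
set x := _ * e in qe *; set k := h - _ => kx.
have sx : star x = x by rewrite starM se star_horner // -comm_horner.
have sk : star k = k by rewrite linearB linearZ /= star1 sh.
clearbody k; case/negP: qe; apply/eqP.
have : star (t *: x) * (t *: x) + star (k * x) * (k * x) = 0.
  rewrite starM sx sk linearZ /= sx -scalerAl -scalerAr scalerA -expr2.
  rewrite -[RHS](mulr0 x) -kx mulrDl mulrDr -scalerAl mul1r -scalerAr expr2.
  by rewrite addrC !mulrA.
move/definite/eqP; rewrite scaler_eq0 (negPf t0) => /eqP //.
Qed.

(** An eigenvector [x = q(h) e] of [h] satisfies [x^2 = q(s) x], so a multiple
    of it is a projection below [e], which minimality identifies with [e]. *)
Lemma minimal_selfadjoint e h : minimal e -> corner e e h -> star h = h ->
  exists s, h = s *: e.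
Proof.
move=> [[se ee] e0 emin] [eh he] sh.
have [s [q]] := eigenvector sh se (etrans he (esym eh)) e0.
set x := _ * e => -[x0 hx].
have hec : h * e = e * h by rewrite he eh.
have ex : e * x = x by rewrite /x comm_horner // mulrA ee.
have sx : star x = x by rewrite starM se star_horner // -comm_horner.
have xx : x * x = q.[s] *: x.
  rewrite {1}/x -mulrA ex; elim/poly_ind: (q) => [|r c IH].
    by rewrite rmorph0 horner0 mul0r scale0r.
  rewrite rmorphD rmorphM /= horner_algX horner_algC mulrDl -mulrA hx.
  by rewrite -scalerAr IH -scalerAl mul1r scalerA -scalerDl !hornerE mulrC.
have qs : q.[s] != 0.
  apply: contra_neq x0 => qs.
  by apply: definite1; rewrite sx xx qs scale0r.
exists s.
have fe : (q.[s])^-1 *: x = e.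
  apply: emin.
  - split; first by rewrite linearZ /= sx.
    by rewrite -scalerAl -scalerAr xx !scalerA -mulrA mulVf // mulr1.
  - by rewrite -scalerAr ex.
  - by rewrite scaler_eq0 invr_eq0 (negPf qs).
by rewrite -he -fe -scalerAr hx !scalerA mulrC.
Qed.

(** The scalar is positive, for otherwise [a] and a real multiple of [f] would
    contradict definiteness. *)
Lemma star_mul_scalar e f a : minimal f -> corner e f a -> a != 0 ->
  exists2 t : R, 0 < t & star a * a = t *: f.
Proof.
move=> fmin [ea af] a0; have [[sf ff] f0 _] := fmin.
have [||t at_] := @minimal_selfadjoint f (star a * a) fmin.
- by split; [rewrite mulrA -{1}sf -starM af | rewrite -mulrA af].
- by rewrite starM starK.
exists t => //; rewrite ltNge; apply: contraNN a0 => t0; apply/eqP.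
apply: (@definite a (Num.sqrt (- t) *: f)).
rewrite linearZ /= sf -scalerAl -scalerAr scalerA -expr2 sqr_sqrtr ?oppr_ge0 //.
by rewrite ff at_ -scalerDl subrr scale0r.
Qed.

Definition partial_isometry (e f w : A) :=
  [/\ corner e f w, star w * w = f & w * star w = e].

(** The scalars by which [a^* a] and [a a^*] differ from [f] and [e] agree,
    since both describe [a a^* a]; their common square root normalizes [a]. *)
Lemma scaled_partial_isometry e f a : minimal e -> minimal f -> corner e f a -> a != 0 ->
  exists2 t : R, 0 < t & partial_isometry e f (t *: a).
Proof.
move=> emin fmin [ea af] a0; have [[se ee] e0 _] := emin.
have [[sf ff] f0 _] := fmin.
have [t t0 ta] := star_mul_scalar fmin (conj ea af) a0.
have [||t' t'0] := @star_mul_scalar f e (star a) emin.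
- by split; [rewrite -{1}sf -starM af | rewrite -{1}se -starM ea].
- by apply: contra_neq a0 => sa; rewrite -[a]starK sa linear0.
rewrite starK => ta'.
have tt : t = t'.
  have : t *: a = t' *: a.
    by rewrite -{1}af scalerAr -ta mulrA ta' -scalerAl ea.
  by move/eqP; rewrite -subr_eq0 -scalerBl scaler_eq0 (negPf a0) orbF subr_eq0 => /eqP.
have st : (Num.sqrt t)^-1 * (Num.sqrt t)^-1 * t = 1.
  by rewrite -invfM -expr2 sqr_sqrtr ?ltW // mulVf // gt_eqF.
exists (Num.sqrt t)^-1; first by rewrite invr_gt0 sqrtr_gt0.
split; first by split; rewrite -?scalerAl -?scalerAr ?ea ?af.
  by rewrite linearZ /= -scalerAl -scalerAr ta !scalerA st scale1r.
by rewrite linearZ /= -scalerAl -scalerAr ta' !scalerA -tt st scale1r.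
Qed.

(** * Minimal projections and the corners they cut out *)

Definition orthogonal_projections (s : seq A) :=
  forall i j, (i < size s)%N -> (j < size s)%N ->
    [/\ star s`_i = s`_i, s`_i != 0 & s`_i * s`_j = s`_i *+ (i == j)].

Lemma orthogonal_projections_free s : orthogonal_projections s -> free s.
Proof.
move=> os; suff: free (in_tuple s) by []; apply/freeP => k k0 i.
have [_ si _] := os i i (ltn_ord i) (ltn_ord i).
apply/eqP; have := congr1 (fun a => a * s`_i) k0.
rewrite mul0r mulr_suml (bigD1 i) //= big1 => [|j ji].
  rewrite addr0 -scalerAl; have [_ _ ->] := os i i (ltn_ord i) (ltn_ord i).
  by rewrite eqxx mulr1n => /eqP; rewrite scaler_eq0 (negPf si) orbF.
rewrite -scalerAl; have [_ _ ->] := os j i (ltn_ord j) (ltn_ord i).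
by rewrite (_ : (_ == _) = false) ?scaler0 //; apply: negPf.
Qed.

Lemma orthogonal_projections_cons f s : projection f -> f != 0 ->
  (forall i, (i < size s)%N -> f * s`_i = 0) ->
  orthogonal_projections s -> orthogonal_projections (f :: s).
Proof.
move=> [sf ff] f0 fs os [|i] [|j] //= il jl.
- by rewrite fs.
- have [si i0 _] := os i i il il; split=> //.
  by rewrite -si -sf -starM fs // linear0.
- exact: os.
Qed.

(** In a family of maximal length the sum is [1], otherwise its complement could
    be added, and each member is minimal, otherwise it could be split in two. *)
Lemma minimal_decomposition : exists s : seq A,
  [/\ orthogonal_projections s, \sum_(i < size s) s`_i = 1 &
      forall i, (i < size s)%N -> minimal s`_i].
Proof.
have onil : orthogonal_projections [::] by [].
have [s os smax] := free_max onil orthogonal_projections_free.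
have nocons f : projection f -> (forall i, (i < size s)%N -> f * s`_i = 0) -> f = 0.
  move=> pf fs; apply/eqP; apply: contraT => f0.
  have /smax := orthogonal_projections_cons pf f0 fs os.
  by rewrite ltnn.
have sumE i : (i < size s)%N -> (\sum_(j < size s) s`_j) * s`_i = s`_i.
  move=> il; rewrite mulr_suml (bigD1 (Ordinal il)) //= big1 => [|j ji].
    by have [_ _ ->] := os i i il il; rewrite eqxx addr0.
  have [_ _ ->] := os j i (ltn_ord j) il.
  by rewrite (_ : (_ == _) = false) //; apply: negPf.
have sum1 : \sum_(i < size s) s`_i = 1.
  apply/eqP; rewrite eq_sym -subr_eq0; apply/eqP; apply: nocons => [|i il].
    set e := \sum_(i < _) _ in sumE *.
    have se : star e = e.
      by rewrite linear_sum; apply: eq_bigr => i _; case: (os i i (ltn_ord i) (ltn_ord i)).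
    have ee : e * e = e.
      by rewrite {2}/e mulr_sumr; apply: eq_bigr => i _; rewrite sumE.
    split; first by rewrite linearB /= star1 se.
    by rewrite mulrBl mul1r mulrBr mulr1 ee subrr subr0.
  by rewrite mulrBl mul1r sumE // subrr.
exists s; split=> // i il; have [si i0 ii] := os i i il il.
rewrite eqxx mulr1n in ii; split=> // f [sf ff] sif f0.
apply/eqP; apply: contraT => fi.
have fsi : f * s`_i = f by rewrite -sf -si -starM sif.
have orth j : (j < size s)%N -> j != i -> f * s`_j = 0.
  move=> jl ji; rewrite -fsi -mulrA; have [_ _ ->] := os i j il jl.
  by rewrite eq_sym (negPf ji) mulr0.
have /smax : orthogonal_projections (f :: set_nth 0 s i (s`_i - f)).
  have sz : size (set_nth 0 s i (s`_i - f)) = size s.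
    by rewrite size_set_nth; apply/maxn_idPr.
  apply: orthogonal_projections_cons => //.
    move=> j; rewrite sz nth_set_nth /= => jl.
    by case: eqP => [_|/eqP ji]; rewrite ?orth // mulrBr fsi ff subrr.
  move=> j l; rewrite sz !nth_set_nth /= => jl ll.
  have [sj j0 _] := os j j jl jl; have [sl l0 _] := os l l ll ll.
  case: (eqVneq j i) => ji; case: (eqVneq l i) => li; split => //.
  - by rewrite linearB /= si sf.
  - by rewrite subr_eq0 eq_sym.
  - rewrite ji li eqxx mulr1n mulrBl !mulrBr ii sif fsi ff.
    by rewrite subrr subr0.
  - by rewrite linearB /= si sf.
  - by rewrite subr_eq0 eq_sym.
  - rewrite ji eq_sym (negPf li) mulrBl orth // subr0.
    by have [_ _ ->] := os i l il ll; rewrite eq_sym (negPf li).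
  - rewrite li (negPf ji) mulrBr; have [_ _ ->] := os j i jl il.
    rewrite (negPf ji) sub0r -{1}sj -sf -starM orth // linear0.
    by rewrite oppr0.
  - by have [_ _ ->] := os j l jl ll.
by rewrite /= size_set_nth (maxn_idPr il) ltnn.
Qed.

(** For minimal [e] the corner [e A e] is [R], [C] or [H].  In all three cases a
    maximal family of anticommuting skew square roots of [- e] spans it together
    with [e], and generates a finite group. *)
Definition clifford (e : A) (s : seq A) :=
  forall i j, (i < size s)%N -> (j < size s)%N ->
    [/\ corner e e s`_i, star s`_i = - s`_i &
        s`_i * s`_j + s`_j * s`_i = - e *+ 2 *+ (i == j)].

Lemma clifford_free e s : e != 0 -> clifford e s -> free s.
Proof.
move=> e0 cs; suff: free (in_tuple s) by []; apply/freeP => k k0 i.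
pose anti a := a * s`_i + s`_i * a.
have : anti (\sum_j k j *: (in_tuple s)`_j) = 0.
  by rewrite k0 /anti mul0r mulr0 addr0.
rewrite /anti mulr_suml mulr_sumr -big_split (bigD1 i) //= big1 => [|j ji].
  rewrite addr0 -scalerAl -scalerAr -scalerDr.
  have [_ _ ->] := cs i i (ltn_ord i) (ltn_ord i); rewrite eqxx mulr1n.
  move/eqP; rewrite scaler_eq0 => /orP [/eqP //|].
  by rewrite -scaler_nat scaler_eq0 pnatr_eq0 /= oppr_eq0 (negPf e0).
rewrite -scalerAl -scalerAr -scalerDr.
have [_ _ ->] := cs j i (ltn_ord j) (ltn_ord i).
by rewrite (_ : (_ == _) = false) ?scaler0 //; apply: negPf.
Qed.

Lemma square_of_skew (e b : A) : b * b + b * b = - e *+ 2 -> b * b = - e.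
Proof.
rewrite -mulr2n => /eqP; rewrite -subr_eq0 -mulrnBl -scaler_nat scaler_eq0.
by rewrite pnatr_eq0 /= subr_eq0 => /eqP.
Qed.

(** The self-adjoint part of the corner is [R e].  Anticommutators of skew
    elements are self-adjoint, hence scalars, and so provide an inner product;
    Gram-Schmidt then turns a skew element outside the span into a new member
    of the family. *)
Lemma clifford_basis e : minimal e -> exists2 s, clifford e s &
  forall B : {vspace A}, e \in B -> (forall b, b \in s -> b \in B) ->
    forall a, corner e e a -> a \in B.
Proof.
move=> emin; have [[se ee] e0 _] := emin.
have cnil : clifford e [::] by [].
have [s cs smax] := free_max cnil (fun s => @clifford_free e s e0).
exists s => // B eB sB.
suff skew c : corner e e c -> star c = - c -> c \in B.
  move=> a [ea ae].
  have -> : a = 2^-1 *: (a + star a) + 2^-1 *: (a - star a).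
    rewrite -scalerDr addrACA subrr addr0 -mulr2n -[a *+ 2]scaler_nat scalerA.
    by rewrite mulVf ?pnatr_eq0 // scale1r.
  have [es se'] : corner e e (star a).
    by split; [rewrite -{1}se -starM ae | rewrite -{1}se -starM ea].
  rewrite memvD ?memvZ //.
    have [||t ->] := @minimal_selfadjoint e (a + star a) emin.
    - by split; rewrite ?mulrDr ?mulrDl ?ea ?ae ?es ?se'.
    - by rewrite linearD /= starK addrC.
    by rewrite memvZ.
  apply: skew; first by split; rewrite ?mulrBr ?mulrBl ?ea ?ae ?es ?se'.
  by rewrite linearB /= starK opprB.
move=> [ec ce] sc.
(* The coordinates of the projection of c onto the span of the family. *)
have /choice [t tE] : forall i : 'I_(size s), exists t : R,
    c * s`_i + s`_i * c = (- t) *: (e *+ 2).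
  move=> i; have [[ei ie] si _] := cs i i (ltn_ord i) (ltn_ord i).
  have [||t tE] := @minimal_selfadjoint e (c * s`_i + s`_i * c) emin.
  - by split; rewrite ?mulrDr ?mulrDl ?mulrA ?ec ?ei -?mulrA ?ce ?ie.
  - by rewrite linearD /= !starM si sc !mulrNN addrC.
  exists (- (2^-1 * t)); rewrite opprK -[e *+ 2]scaler_nat scalerA tE.
  by rewrite mulrAC mulVf ?pnatr_eq0 // mul1r.
pose c' := c - \sum_(i < size s) t i *: s`_i.
have c'E : c = c' + \sum_(i < size s) t i *: s`_i by rewrite subrK.
have [c'0|c'0] := eqVneq c' 0.
  rewrite c'E c'0 add0r memv_suml // => i _.
  by rewrite memvZ // sB // mem_nth.
have sc' : star c' = - c'.
  rewrite linearB /= sc opprB addrC; congr (_ + _).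
  rewrite linear_sum -sumrN; apply: eq_bigr => i _.
  by have [_ si _] := cs i i (ltn_ord i) (ltn_ord i); rewrite linearZ /= si scalerN opprK.
have cc' : corner e e c'.
  split; rewrite ?mulrBr ?mulrBl ?ec ?ce ?mulr_suml ?mulr_sumr; congr (_ - _);
    apply: eq_bigr => i _; have [[ei ie] _ _] := cs i i (ltn_ord i) (ltn_ord i).
    by rewrite -scalerAr ei.
  by rewrite -scalerAl ie.
have anti' i : (i < size s)%N -> c' * s`_i + s`_i * c' = 0.
  move=> il; rewrite mulrBl mulrBr addrACA -opprD.
  rewrite (tE (Ordinal il)) mulr_suml mulr_sumr -big_split (bigD1 (Ordinal il)) //=.
  rewrite big1 => [|j ji].
    rewrite addr0 -scalerAl -scalerAr -scalerDr.
    have [_ _ ->] := cs i i il il; rewrite eqxx mulr1n.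
    by rewrite mulNrn scalerN scaleNr subrr.
  rewrite -scalerAl -scalerAr -scalerDr; have [_ _ ->] := cs j i (ltn_ord j) il.
  by rewrite (_ : (_ == _) = false) ?scaler0 //; apply: negPf.
have [r r0 [[eb be] bb _]] := scaled_partial_isometry emin emin cc' c'0.
set b := r *: c' in eb be bb.
have sb : star b = - b by rewrite linearZ /= sc' scalerN.
have /smax : clifford e (b :: s).
  have antib i : (i < size s)%N -> b * s`_i + s`_i * b = 0.
    by move=> il; rewrite -scalerAl -scalerAr -scalerDr anti' // scaler0.
  move=> [|i] [|j] //= il jl.
  - split=> //; rewrite mulr1n mulr2n; move: bb; rewrite sb mulNr => bb.
    by rewrite -bb opprK.
  - by split=> //; exact: antib.
  - by have [ci si _] := cs i i il il; split=> //; rewrite addrC; exact: antib.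
  - exact: cs.
by rewrite ltnn.
Qed.

(** The elements [+/- b_1^{m_1} ... b_k^{m_k}] with exponents [0] or [1]. *)
Fixpoint signed_products (e : A) (s : seq A) : seq A :=
  if s is b :: s' then
    signed_products e s' ++ [seq b * x | x <- signed_products e s']
  else [:: e; - e].

Lemma clifford_cons e b s : clifford e (b :: s) ->
  [/\ clifford e s, corner e e b, star b = - b, b * b = - e &
      forall c, c \in s -> c * b = - (b * c)].
Proof.
move=> cs; have [cb sb bb] := cs 0%N 0%N (ltn0Sn _) (ltn0Sn _).
split=> //.
- by move=> i j il jl; exact: (cs i.+1 j.+1).
- by apply: square_of_skew; move: bb; rewrite eqxx mulr1n.
move=> c /(nthP 0) [i il <-].
have [_ _ /= /eqP] := cs i.+1 0%N il (ltn0Sn _).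
by rewrite addr_eq0 => /eqP.
Qed.

Section SignedProducts.
Variable e : A.
Hypothesis pe : projection e.

Lemma signed_products_opp s x :
  x \in signed_products e s -> - x \in signed_products e s.
Proof.
elim: s x => [|b s IH] x /=.
  by rewrite !inE => /orP [] /eqP ->; rewrite ?opprK eqxx ?orbT.
rewrite !mem_cat => /orP [xs|/mapP [y ys ->]]; apply/orP; first by left; exact: IH.
by right; apply/mapP; exists (- y); rewrite ?mulrN //; exact: IH.
Qed.

Lemma signed_products_corner s x : clifford e s ->
  x \in signed_products e s -> corner e e x.
Proof.
have [se ee] := pe.
elim: s x => [|b s IH] x /=.
  by move=> _; rewrite !inE => /orP [] /eqP ->; split; rewrite ?mulrN ?mulNr ee.
move=> /clifford_cons [cs [eb be] _ _ _]; rewrite mem_cat.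
move=> /orP [/(IH _ cs) //|/mapP [y /(IH _ cs) [ey ye] ->]].
by split; [rewrite mulrA eb | rewrite -mulrA ye].
Qed.

(** Moving [b] across a signed product of elements anticommuting with it costs
    at most a sign; this is what closes the set under products. *)
Lemma signed_products_anti s x b : clifford e s -> corner e e b ->
  (forall c, c \in s -> c * b = - (b * c)) -> x \in signed_products e s ->
  x * b = b * x \/ x * b = - (b * x).
Proof.
move=> + [eb be]; elim: s x => [|c s IH] x /=.
  move=> _ _; rewrite !inE => /orP [] /eqP ->;
  by left; rewrite ?mulNr ?mulrN eb be.
move=> /clifford_cons [cs _ _ _ _] anti; rewrite mem_cat.
have anti' a : a \in s -> a * b = - (b * a).
  by move=> as_; apply: anti; rewrite inE as_ orbT.
move=> /orP [|/mapP [y ys ->]]; first exact: IH.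
have cb : c * b = - (b * c) by apply: anti; rewrite inE eqxx.
by case: (IH y cs anti' ys) => yb; [right|left];
  rewrite -(mulrA c) yb ?mulrN (mulrA c b) cb mulNr ?opprK (mulrA b).
Qed.

Lemma signed_products_id s : e \in signed_products e s.
Proof. by elim: s => [|b s IH] /=; rewrite ?inE ?eqxx // mem_cat IH. Qed.

Lemma signed_products_gen s b : clifford e s -> b \in s ->
  b \in signed_products e s.
Proof.
elim: s => [|c s IH] //= /clifford_cons [cs [_ ce] _ _ _]; rewrite inE mem_cat.
move=> /orP [/eqP ->|/(IH cs) -> //]; apply/orP; right; apply/mapP.
by exists e; rewrite ?signed_products_id.
Qed.

Lemma signed_products_mul s x y : clifford e s ->
  x \in signed_products e s -> y \in signed_products e s ->
  x * y \in signed_products e s.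
Proof.
have [se ee] := pe.
elim: s x y => [|b s IH] x y /=.
  move=> _; rewrite !inE => /orP [] /eqP -> /orP [] /eqP ->;
  by rewrite ?mulrN ?mulNr ?opprK ee eqxx ?orbT.
move=> /clifford_cons [cs cb _ bb anti]; rewrite !mem_cat.
move=> /orP [xs|/mapP [x' x's ->]] /orP [ys|/mapP [y' y's ->]]; apply/orP.
- by left; exact: IH.
- right; apply/mapP; case: (signed_products_anti cs cb anti xs) => xb.
    by exists (x * y'); [exact: IH | rewrite mulrA xb mulrA].
  exists (- (x * y')); first by apply: signed_products_opp; exact: IH.
  by rewrite mulrA xb mulrN mulNr mulrA.
- by right; apply/mapP; exists (x' * y); [exact: IH | rewrite mulrA].
- left; have [ex _] := signed_products_corner cs x's.
  have E : b * b * (x' * y') = - (x' * y').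
    by rewrite bb mulNr mulrA ex.
  have N := IH _ _ cs x's y's.
  rewrite mulrA -[b * x' * b]mulrA.
  case: (signed_products_anti cs cb anti x's) => ->.
    by rewrite mulrA -mulrA E signed_products_opp.
  by rewrite mulrN mulrA mulNr -mulrA E opprK.
Qed.

Lemma signed_products_star s x : clifford e s ->
  x \in signed_products e s -> star x \in signed_products e s.
Proof.
have [se ee] := pe.
elim: s x => [|b s IH] x /=.
  by move=> _; rewrite !inE => /orP [] /eqP ->; rewrite ?linearN /= se eqxx ?orbT.
move=> /clifford_cons [cs cb sb _ anti]; rewrite !mem_cat.
move=> /orP [xs|/mapP [y ys ->]]; apply/orP; first by left; exact: IH.
right; apply/mapP; have sys := IH _ cs ys.
case: (signed_products_anti cs cb anti sys) => yb.
  exists (- star y); first exact: signed_products_opp.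
  by rewrite starM sb !mulrN yb.
by exists (star y) => //; rewrite starM sb !mulrN yb opprK.
Qed.

Lemma signed_products_unit s x : clifford e s ->
  x \in signed_products e s -> star x * x = e.
Proof.
have [se ee] := pe.
elim: s x => [|b s IH] x /=.
  by move=> _; rewrite !inE => /orP [] /eqP ->;
  rewrite ?linearN /= ?mulrNN se ee.
move=> /clifford_cons [cs cb sb bb anti]; rewrite mem_cat.
move=> /orP [/(IH _ cs) //|/mapP [y ys ->]].
have [ey _] := signed_products_corner cs ys.
by rewrite starM -mulrA (mulrA (star b)) sb mulNr bb opprK ey IH.
Qed.

End SignedProducts.

Definition is_finite_unit_group (e : A) (Q : seq A) :=
  [/\ e \in Q, forall x, x \in Q -> - x \in Q,
      forall x y, x \in Q -> y \in Q -> x * y \in Q,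
      forall x, x \in Q -> star x \in Q &
      forall x, x \in Q -> corner e e x /\ star x * x = e].

Lemma minimal_unit_group e : minimal e -> exists2 Q : seq A,
  is_finite_unit_group e Q &
  forall B : {vspace A}, (forall x, x \in Q -> x \in B) ->
    forall a, corner e e a -> a \in B.
Proof.
move=> emin; have [pe _ _] := emin; have [s cs sB] := clifford_basis emin.
exists (signed_products e s).
  split.
  - exact: signed_products_id.
  - exact: signed_products_opp.
  - by move=> *; apply: signed_products_mul.
  - by move=> *; apply: signed_products_star.
  - by move=> *; split; [apply: signed_products_corner cs _ | apply: signed_products_unit cs _].
move=> B QB; apply: sB => [|b bs]; apply: QB; first exact: signed_products_id.
exact: signed_products_gen.
Qed.

(** * A finite groupoid of partial isometries *)

Lemma partial_isometry_id e : projection e -> partial_isometry e e e.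
Proof. by move=> [se ee]; rewrite /partial_isometry /corner se !ee. Qed.

Lemma partial_isometry_star e f w : projection e -> projection f ->
  partial_isometry e f w -> partial_isometry f e (star w).
Proof.
move=> [se _] [sf _] [[ew wf] ww ww']; split; rewrite ?starK //.
by split; [rewrite -{1}sf -starM wf | rewrite -{1}se -starM ew].
Qed.

Lemma partial_isometry_mul e f g v w :
  partial_isometry e f v -> partial_isometry f g w -> partial_isometry e g (v * w).
Proof.
move=> [[ev vf] vv vv'] [[fw wg] ww ww']; split.
- by split; [rewrite mulrA ev | rewrite -mulrA wg].
- by rewrite starM -mulrA (mulrA (star v)) vv fw ww.
- by rewrite starM -mulrA (mulrA w) ww' mulrA vf vv'.
Qed.

Definition frame k (e : 'I_k -> A) :=
  [/\ forall i, projection (e i), forall i j, e i * e j = e i *+ (i == j) &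
      \sum_i e i = 1].

(** The properties that matter of a set [M] consisting of [0] and of the
    morphisms of a finite groupoid with objects [e i], whose inverse is the
    involution. *)
Definition finite_groupoid k (e : 'I_k -> A) (M : seq A) :=
  [/\ 0 \in M /\ forall i, e i \in M, forall m, m \in M -> - m \in M,
      forall m n, m \in M -> n \in M -> m * n \in M,
      forall m, m \in M -> star m \in M &
      forall i j m, m \in M -> corner (e i) (e j) m -> m != 0 ->
        partial_isometry (e i) (e j) m].

(** Call [i] and [j] connected when a partial isometry links [e i] to [e j].
    With a representative [r] chosen in each class, partial isometries [w i]
    from [e i] to [e r], and a finite unit group [Q] spanning [e r A e r], the
    elements [w i * q * (w j)^*] multiply like elementary matrices with
    coefficients in [Q]. *)
Lemma finite_groupoid_exists : exists k (e : 'I_k -> A) (M : seq A),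
  [/\ frame e, finite_groupoid e M &
    forall B : {vspace A}, forall i j,
      (forall m, m \in M -> corner (e i) (e j) m -> m \in B) ->
      forall a, corner (e i) (e j) a -> a \in B].
Proof.
have [s [os sum1 smin]] := minimal_decomposition.
pose e (i : 'I_(size s)) := s`_i.
have emin i : minimal (e i) by exact: smin.
have pe i : projection (e i) by case: (emin i).
have ee i j : e i * e j = e i *+ (i == j).
  by have [_ _] := os i j (ltn_ord i) (ltn_ord j).
have fe : frame e by [].
pose conn i j := `[< exists w, partial_isometry (e i) (e j) w >].
have conn_sym i j : conn i j -> conn j i.
  by move=> /asboolP [w ww]; apply/asboolP; exists (star w); apply: partial_isometry_star.
have conn_trans i j l : conn i j -> conn j l -> conn i l.
  move=> /asboolP [v vv] /asboolP [w ww]; apply/asboolP.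
  by exists (v * w); apply: partial_isometry_mul vv ww.
have conn_refl i : conn i i.
  by apply/asboolP; exists (e i); apply: partial_isometry_id.
pose rep i := odflt i [pick j | conn i j].
have conn_rep i : conn i (rep i).
  by rewrite /rep; case: pickP.
have rep_conn i j : conn i j -> rep i = rep j.
  move=> cij; rewrite /rep (@eq_pick _ (conn i) (conn j)); last first.
    move=> l; apply/idP/idP; [exact: conn_trans (conn_sym _ _ cij)|exact: conn_trans].
  by case: pickP => //= /(_ j); rewrite conn_refl.
have /choice [w wP] : forall i, exists w, partial_isometry (e i) (e (rep i)) w.
  by move=> i; apply/asboolP; exact: conn_rep.
have /choice [Q QP] : forall i, exists Q : seq A, is_finite_unit_group (e i) Q /\
  forall B : {vspace A}, (forall x, x \in Q -> x \in B) ->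
    forall a, corner (e i) (e i) a -> a \in B.
  by move=> i; have [Q Q1 Q2] := minimal_unit_group (emin i); exists Q.
pose mon (i j : 'I_(size s)) q := w i * q * star (w j).
pose linked := [seq p <- enum {: 'I_(size s) * 'I_(size s)} | rep p.1 == rep p.2].
pose M := 0 :: [seq mon p.1 p.2 q | p <- linked, q <- Q (rep p.1)].
have MP m : m \in M <-> m = 0 \/ exists i j q,
    [/\ rep i = rep j, q \in Q (rep i) & m = mon i j q].
  rewrite inE; split=> [/orP [/eqP|/allpairsPdep [[i j] [q [+ qQ ->]]]]|].
  - by left.
  - by rewrite mem_filter /= => /andP [/eqP ij _]; right; exists i, j, q.
  case=> [->|[i [j [q [ij qQ ->]]]]]; first by rewrite eqxx.
  apply/orP; right; apply/allpairsPdep; exists (i, j), q; split => //.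
  by rewrite mem_filter mem_enum /= ij eqxx.
have monP i j q : rep i = rep j -> q \in Q (rep i) ->
    partial_isometry (e i) (e j) (mon i j q).
  move=> ij qQ; have [[_ _ _ Qs Qu] _] := QP (rep i).
  have [qc qq] := Qu _ qQ.
  have pq : partial_isometry (e (rep i)) (e (rep i)) q.
    split=> //; have [_] := Qu _ (Qs _ qQ); by rewrite starK.
  apply: partial_isometry_mul (partial_isometry_mul (wP i) pq) _.
  by rewrite ij; apply: partial_isometry_star.
exists (size s), e, M; split=> //.
  split.
  - split=> [|i]; first by rewrite inE eqxx.
    apply/MP; right; exists i, i, (e (rep i)).
    have [[Q1 _ _ _ _] _] := QP (rep i); split=> //.
    by rewrite /mon; have [[_ ->] _ ->] := wP i.
  - move=> m /MP [->|[i [j [q [ij qQ ->]]]]]; apply/MP; [by left; rewrite oppr0|right].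
    have [[_ Qo _ _ _] _] := QP (rep i); exists i, j, (- q); split=> //; first exact: Qo.
    by rewrite /mon mulrN mulNr.
  - move=> m n /MP [->|[i [j [q [ij qQ ->]]]]].
      by move=> _; apply/MP; left; rewrite mul0r.
    move=> /MP [->|[k [l [q' [kl qQ' ->]]]]]; apply/MP; first by left; rewrite mulr0.
    have [eqjk|jk] := eqVneq j k; last first.
      left; have [[_ <-] _ _] := monP _ _ _ ij qQ.
      have [[<- _] _ _] := monP _ _ _ kl qQ'.
      by rewrite mulrA -(mulrA _ (e j)) ee (negPf jk) mulr0 mul0r.
    subst k; right; have [[_ _ Qm _ Qu] _] := QP (rep i).
    rewrite -ij in qQ'; exists i, l, (q * q'); split; [by rewrite ij | exact: Qm |].
    have [[qe eq] _] := Qu _ qQ; have [_ ww _] := wP j.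
    rewrite /mon !mulrA -(mulrA _ (star (w j))) ww -ij.
    by rewrite -(mulrA (w i) q) eq.
  - move=> m /MP [->|[i [j [q [ij qQ ->]]]]]; apply/MP; [by left; rewrite linear0|right].
    have [[_ _ _ Qs _] _] := QP (rep i); exists j, i, (star q); split=> //.
      by rewrite -ij; exact: Qs.
    by rewrite /mon !starM starK mulrA.
  - move=> i j m /MP [->|[i' [j' [q [ij qQ ->]]]]]; first by rewrite eqxx.
    have mp := monP _ _ _ ij qQ; have [[em me] _ _] := mp.
    move=> [im mj] m0; suff [-> ->] : i = i' /\ j = j' by [].
    split; apply/eqP; apply: contraNT m0 => ne.
      by rewrite -im -em mulrA ee (negPf ne) mul0r.
    by rewrite -mj -me -mulrA ee (eq_sym j') (negPf ne) mulr0.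
move=> B i j MB a ac; have [->|a0] := eqVneq a 0; first exact: mem0v.
have ij : rep i = rep j.
  apply: rep_conn; apply/asboolP.
  by have [t _ ta] := scaled_partial_isometry (emin i) (emin j) ac a0; exists (t *: a).
have [[Q1 Qo Qm Qs Qu] Qspan] := QP (rep i).
have [[iw wi] ww1 ww2] := wP i; have [[jw wj] ww3 ww4] := wP j.
have [ia aj] := ac.
have sp i' : star (e i') = e i' by case: (pe i').
(* Conjugation by w i and w j carries a into the corner of the representative. *)
have acE : w i * (star (w i) * a * w j) * star (w j) = a.
  by rewrite !mulrA ww2 ia -mulrA ww4 aj.
pose f := linfun (amulr (star (w j)) \o amull (w i))%VF.
have fE x : f x = mon i j x by rewrite lfunE /= comp_lfunE !lfunE.
suff : star (w i) * a * w j \in (f @^-1: B)%VS by rewrite -memv_preim fE /mon acE.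
apply: Qspan => [x xQ|].
  rewrite -memv_preim fE; apply: MB.
    by apply/MP; right; exists i, j, x.
  by have [] := monP _ _ _ ij xQ.
split; first by rewrite !mulrA -{1}sp -starM wi.
by rewrite -!mulrA ij wj.
Qed.

(** * The finite group of monomial unitaries *)

(** Left multiplication by [b] is injective, hence onto in finite dimension. *)
Lemma mulr1_comm (a b : A) : a * b = 1 -> b * a = 1.
Proof.
move=> ab; have kb : lker (amull b) == 0%VS.
  apply/lker0P => x y; rewrite !lfunE /= => bxy.
  by rewrite -[x]mul1r -[y]mul1r -ab -!mulrA bxy.
have : (1 : A) \in limg (amull b) by rewrite lker0_limgf // memvf.
move=> /memv_imgP [c _]; rewrite lfunE /= => bc.
by rewrite bc; congr (_ * _); rewrite -[c]mul1r -ab -mulrA -bc mulr1.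
Qed.

(** [G] consists of the unitaries whose entries [e i * u * e j] all lie in the
    finite groupoid.  It is finite since [u] is the sum of its entries.  It is
    closed under products because a unitary with such entries is monomial: one
    nonzero entry of row [i] already has [m m^* = e i].  It generates because
    reflections [1 - 2 e i] recover the projections, and every [m] in the
    groupoid is an entry of an element of [G]. *)
Lemma finite_generating_group : exists G : set A,
  [/\ finite_set G, is_subgroup star G, generates star G & G (- 1)].
Proof.
have [k [e [M [[pe ee e1] [[M0 eM] Mo Mm Ms Mp] Mspan]]]] := finite_groupoid_exists.
have se i : star (e i) = e i by case: (pe i).
pose G : set A := [set u | u * star u = 1 /\ forall i j, e i * u * e j \in M].
have uG u : G u -> star u * u = 1 by move=> [/mulr1_comm].
(* The rest z of row i has z z^* = e i - e i = 0. *)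
have row u i : G u -> e i * u = 0 \/ exists j, e i * u * e j = e i * u.
  move=> [uu uM].
  case: (pickP (fun j => e i * u * e j != 0)) => [j xj|x0]; last first.
    left; rewrite -[_ * u]mulr1 -e1 mulr_sumr big1 // => j _.
    by apply/eqP; have := x0 j; rewrite /= => /negbFE.
  right; exists j.
    have pij : partial_isometry (e i) (e j) (e i * u * e j).
      apply: Mp => //; have [[_ eie] [_ eje]] := (pe i, pe j).
      by split; [rewrite !mulrA eie | rewrite -!mulrA eje].
    have z0 : star (e i * u * (1 - e j)) = 0.
      apply: definite1; rewrite starK !starM !se linearB /= star1 se.
      have [_ eje] := pe j; have [_ eie] := pe i.
      have ej1 : (1 - e j) * (1 - e j) = 1 - e j.
        by rewrite mulrBl mul1r mulrBr mulr1 eje subrr subr0.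
      have [_ _ wE] := pij; rewrite !starM !se in wE.
      have wE' : e i * (u * (e j * (star u * e i))) = e i.
        by rewrite -[RHS]wE -!mulrA (mulrA (e j) (e j)) eje.
      rewrite -!mulrA (mulrA (1 - e j)) ej1 mulrBl mul1r !mulrBr wE'.
      by rewrite (mulrA u) uu mul1r eie subrr.
    rewrite mulrBr mulr1 in z0; apply/esym/eqP; rewrite -subr_eq0.
    by rewrite -[_ - _]starK z0 linear0.
have Gmul u v : G u -> G v -> G (u * v).
  move=> Gu [vv vM]; have [uu uM] := Gu; split.
    by rewrite starM -mulrA (mulrA v) vv mul1r.
  move=> i j; rewrite mulrA; case: (row u i Gu) => [->|[l <-]].
    by rewrite !mul0r.
  have [_ ell] := pe l.
  have := Mm _ _ (uM i l) (vM l j).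
  by rewrite -!mulrA (mulrA (e l) (e l)) ell.
have Gstar u : G u -> G (star u).
  move=> Gu; have [uu uM] := Gu; split; first by rewrite starK uG.
  by move=> i j; have := Ms _ (uM j i); rewrite !starM !se mulrA.
have entry i j m l l' : corner (e i) (e j) m ->
    e l * m * e l' = m *+ ((l == i) && (l' == j)).
  move=> [im mj]; case: (eqVneq l i) => [->|li] /=; last first.
    by rewrite -im mulrA ee (negPf li) !mul0r.
  rewrite im; case: (eqVneq l' j) => [->|lj] /=; first by rewrite mj.
  by rewrite -mj -mulrA ee eq_sym (negPf lj) mulr0.
have eMb l (b : bool) : e l *+ b \in M by case: b; rewrite ?mulr1n ?mulr0n.
have eie i : corner (e i) (e i) (e i) by have [_] := pe i.
have entry_diag l l' : e l * 1 * e l' = e l *+ (l == l') by rewrite mulr1.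
(* Complete m by the identity on the diagonal, or m + m^* off the diagonal. *)
have GM i j m : m \in M -> corner (e i) (e j) m -> m != 0 ->
    exists2 u, G u & e i * u * e j = m.
  move=> mM mc m0; have [_ mm mm'] := Mp i j m mM mc m0; have [im mj] := mc.
  have [ij|ij] := eqVneq i j.
    subst j; have [_ eei] := pe i; exists (m + (1 - e i)); last first.
      rewrite !(mulrDr, mulrDl, mulrN, mulNr) (entry i i m) //.
      by rewrite (entry i i (e i)) // entry_diag !eqxx subrr addr0.
    split.
      have [si' is'] : corner (e i) (e i) (star m).
        by split; [rewrite -{1}se -starM mj | rewrite -{1}se -starM im].
      set c := 1 - e i.
      have mc0 : m * c = 0 by rewrite mulrBr mulr1 mj subrr.
      have cm0 : c * star m = 0 by rewrite mulrBl mul1r si' subrr.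
      have cc : c * c = c by rewrite mulrBr mulr1 mulrBl mul1r eei subrr subr0.
      have sc : star c = c by rewrite linearB /= star1 se.
      have cE : c = 1 - e i by []; clearbody c.
      rewrite linearD /= sc mulrDl !mulrDr mm' mc0 cm0 cc addr0 add0r.
      by rewrite cE addrC subrK.
    move=> l l'; rewrite !(mulrDr, mulrDl, mulrN, mulNr).
    rewrite (entry i i m) // (entry i i (e i)) // entry_diag.
    case: (eqVneq l i) => [->|li] /=.
      by rewrite [i == l']eq_sym; case: eqP => _; rewrite ?subrr ?addr0.
    by rewrite subr0 add0r.
  have sc : corner (e j) (e i) (star m).
    by split; [rewrite -{1}se -starM mj | rewrite -{1}se -starM im].
  have [js si'] := sc.
  exists (m + star m + (1 - e i - e j)); last first.
    rewrite !(mulrDr, mulrDl, mulrN, mulNr) (entry i j m) // (entry j i (star m)) //.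
    rewrite (entry i i (e i)) // (entry j j (e j)) // entry_diag.
    by rewrite !eqxx (negPf ij) /= [j == i]eq_sym (negPf ij) /= !subr0 !addr0.
  split.
    set c := 1 - e i - e j.
    have ij0 : e i * e j = 0 by rewrite ee (negPf ij).
    have ji0 : e j * e i = 0 by rewrite ee eq_sym (negPf ij).
    have [[_ eei] [_ ejj]] := (pe i, pe j).
    have ic : e i * c = 0 by rewrite !mulrBr mulr1 eei ij0 subrr subr0.
    have jc : e j * c = 0 by rewrite !mulrBr mulr1 ejj ji0 subr0 subrr.
    have ci : c * e i = 0 by rewrite !mulrBl mul1r eei ji0 subrr subr0.
    have cj : c * e j = 0 by rewrite !mulrBl mul1r ejj ij0 subr0 subrr.
    have cc : c * c = c by rewrite {1}/c !mulrBl mul1r ic jc !subr0.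
    have sc' : star c = c by rewrite !linearB /= star1 !se.
    have mc0 : m * c = 0 by rewrite -mj -mulrA jc mulr0.
    have cm0 : c * m = 0 by rewrite -im mulrA ci mul0r.
    have nc0 : star m * c = 0 by rewrite -si' -mulrA ic mulr0.
    have cn0 : c * star m = 0 by rewrite -js mulrA cj mul0r.
    have mm0 : m * m = 0.
      by rewrite -[in X in X * _]mj -mulrA -{2}im (mulrA (e j)) ji0 mul0r mulr0.
    have nn0 : star m * star m = 0 by rewrite -starM mm0 linear0.
    have cE : c = 1 - e i - e j by []; clearbody c.
    rewrite !linearD /= starK sc' !mulrDl !mulrDr.
    rewrite mm' mm mm0 nn0 mc0 nc0 cm0 cn0 cc !addr0 !add0r.
    by rewrite cE -(addrA 1) -opprD subrKC.
  move=> l l'; rewrite !(mulrDr, mulrDl, mulrN, mulNr) (entry i j m) //.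
  rewrite (entry j i (star m)) //.
  rewrite (entry i i (e i)) // (entry j j (e j)) // entry_diag.
  have ij' : (j == i) = false by rewrite eq_sym (negPf ij).
  case: (eqVneq l i) => [->|li] /=.
    rewrite (negPf ij) /= !subr0 addr0; case: (eqVneq l' j) => [->|lj] /=.
      by rewrite (negPf ij) ij' subr0 addr0.
    by rewrite eq_sym add0r; case: eqP => _; rewrite ?subrr ?subr0.
  rewrite add0r subr0; case: (eqVneq l j) => [->|lj] /=.
    case: (eqVneq l' i) => [->|li'] /=; first by rewrite ij' (negPf ij) subr0 addr0 Ms.
    by rewrite eq_sym add0r; case: eqP => _; rewrite ?subrr ?subr0.
  by rewrite subr0 add0r.
have GN1 : G (- 1).
  split; first by rewrite linearN /= star1 mulrNN mulr1.
  move=> i j; rewrite mulrN mulNr mulr1 ee; apply: Mo.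
  by case: eqP => _; rewrite ?mulr1n.
exists G; split=> //.
- pose T := {ffun 'I_k * 'I_k -> 'I_(size M)}.
  pose F (f : T) : A := \sum_i \sum_j M`_(f (i, j)).
  apply: (@sub_finite_set _ _ (range F)); last first.
    by apply: finite_image; exact: finite_finset.
  move=> u [uu uM].
  have lt i j : (index (e i * u * e j)%R M < size M)%N.
    by rewrite index_mem; exact: uM.
  exists [ffun p => Ordinal (lt p.1 p.2)] => //.
  rewrite /F -[RHS]mulr1 -[u in RHS]mul1r -e1 !mulr_suml; apply: eq_bigr => i _.
  by rewrite mulr_sumr; apply: eq_bigr => j _; rewrite ffunE /= nth_index.
- split=> //.
  + by move=> u [].
  + by rewrite -[1]opprK -mulN1r; apply: Gmul.
  + move=> u Gu; have [uu _] := Gu; have uu' := uG _ Gu.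
    have uunit : u \is a GRing.unit by apply/unitrP; exists (star u).
    suff -> : u^-1 = star u by exact: Gstar.
    by rewrite -[LHS]mulr1 -uu mulKr.
move=> B [B1 Bm Bs] GB.
have eB i : e i \in B.
  have [_ eei] := pe i.
  have Gs : G (1 - e i *+ 2).
    split.
      have -> : star (1 - e i *+ 2) = 1 - e i *+ 2.
        by rewrite raddfB /= star1 raddfMn /= se.
      have ge : (1 - e i *+ 2) * e i = - e i.
        by rewrite mulrBl mul1r mulrnAl eei mulr2n opprD addNKr.
      by rewrite mulrBr mulr1 mulrnAr ge mulNrn opprK subrK.
    move=> l l'; rewrite mulrBr mulrBl mulrnAr mulrnAl entry_diag.
    rewrite (entry i i (e i)) //.
    case: (eqVneq l i) => [->|li] /=; last by rewrite mul0rn subr0; case: eqP.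
    rewrite eq_sym; case: eqP => _; last by rewrite mul0rn subr0.
    by rewrite mulr1n opprD addNKr; exact: Mo.
  have -> : e i = 2^-1 *: (1 - (1 - e i *+ 2)).
    by rewrite subKr -[e i *+ 2]scaler_nat scalerA mulVf ?pnatr_eq0 // scale1r.
  by rewrite memvZ // memvB // GB.
apply/vspaceP => a; rewrite memvf.
have -> : a = \sum_i \sum_j e i * a * e j.
  rewrite -[LHS]mulr1 -[a in LHS]mul1r -e1 !mulr_suml; apply: eq_bigr => i _.
  by rewrite mulr_sumr.
rewrite memv_suml // => i _; rewrite memv_suml // => j _.
apply: (Mspan _ i j) => [m mM mc|]; last first.
  have [[_ eii] [_ ejj]] := (pe i, pe j).
  by split; [rewrite !mulrA eii | rewrite -!mulrA ejj].
have [->|m0] := eqVneq m 0; first exact: mem0v.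
have [u Gu <-] := GM i j m mM mc m0.
exact: (Bm _ _ (Bm _ _ (eB i) (GB _ Gu)) (eB j)).
Qed.
End Algebra.

(** * The Haar measure of a finite group *)

Section CountingLaw.
Variables (R : realType) (A : falgType R).

Definition coordinate (i : 'I_(dim A)) (x : A) : R := v2r x 0 i.

Lemma coordinate_continuous i : continuous (coordinate i : natural_space A -> R).
Proof.
move=> x; apply: (@continuous_comp _ _ _ (v2r : natural_space A -> 'rV[R]_(dim A))
  (fun M : 'rV[R]_(dim A) => M 0 i)); last exact: coord_continuous.
exact: initial_continuous.
Qed.

Lemma coordinate_measurable i :
  measurable_fun setT (coordinate i : borel_space A -> R).
Proof.
apply: (measurability _ (RGenOpens.measurableE R)) => _ [B [a [b ->]] <-].
rewrite setTI; apply: sub_sigma_algebra => /=.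
by apply: open_comp; [move=> x _; exact: coordinate_continuous | exact: interval_open].
Qed.

(** A point is the intersection of the level sets of its coordinates. *)
Lemma measurable_singleton (a : A) : measurable ([set a] : set (borel_space A)).
Proof.
have -> : [set a] = \bigcap_(i in [set: 'I_(dim A)]) (coordinate i @^-1` [set coordinate i a]).
  apply/seteqP; split=> [_ -> //|b /= ba].
  by apply: (can_inj v2rK); apply/rowP => i; exact: ba.
apply: fin_bigcap_measurable; first exact: finite_finset.
by move=> i _; rewrite -[_ @^-1` _]setTI; apply: coordinate_measurable.
Qed.

Lemma measurable_finite_set (G : set A) : finite_set G ->
  measurable (G : set (borel_space A)).
Proof.
move=> /finite_seqP [s ->]; elim: s => [|a s IH].
  by rewrite (_ : [set` _] = set0) //; apply/seteqP; split.
rewrite (_ : [set` _] = [set a] `|` [set` s]).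
  by apply: measurableU => //; exact: measurable_singleton.
apply/seteqP; split=> [b|b] /=; rewrite inE.
  by move=> /orP [/eqP|]; [left|right].
by case=> [->|->]; rewrite ?eqxx ?orbT.
Qed.

Variables (s : seq A).
Hypothesis s0 : (0 < size s)%N.

Let point_masses (k : nat) : {measure set (borel_space A) -> \bar R} :=
  @dirac _ (borel_space A) s`_k R.

Let weight : {nonneg R} := ((size s)%:R^-1)%:nng.

Definition counting_law : set (borel_space A) -> \bar R :=
  mscale weight (msum point_masses (size s)).

HB.instance Definition _ := Measure.on counting_law.

Lemma counting_lawE (E : set (borel_space A)) :
  counting_law E = ((size s)%:R^-1 * \sum_(a <- s) \1_E a)%:E.
Proof.
rewrite /counting_law /mscale /= /msum EFinM (big_nth 0) big_mkord sumEFin.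
by congr (_ * _)%E.
Qed.

Lemma counting_law_full (E : set (borel_space A)) : {in s, forall a, E a} ->
  counting_law E = 1%E.
Proof.
move=> sE; rewrite counting_lawE big_seq (eq_bigr (fun=> 1)) => [|a /sE Ea].
  by rewrite -big_seq big_const_seq count_predT iter_addr_0 mulVf // pnatr_eq0 -lt0n.
by rewrite indicE mem_set.
Qed.

HB.instance Definition _ := Measure_isProbability.Build _ _ R counting_law
  (@counting_law_full setT (fun _ _ => I)).

Lemma ge0_integral_counting_law (D : set (borel_space A)) (f : borel_space A -> \bar R) :
  measurable D -> {in s, forall a, D a} -> measurable_fun D f ->
  (forall x, D x -> (0 <= f x)%E) ->
  (\int[counting_law]_(x in D) f x = ((size s)%:R^-1)%:E * \sum_(a <- s) f a)%E.
Proof.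
move=> mD sD mf f0; rewrite ge0_integral_mscale //; congr (_ * _)%E.
rewrite ge0_integral_measure_sum // (big_nth 0) big_mkord.
apply: eq_bigr => i _; rewrite integral_dirac // diracE mem_set ?mul1e //.
by apply: sD; exact: mem_nth.
Qed.

Definition counting_probability : probability (borel_space A) R := counting_law.

End CountingLaw.

(** Counting is invariant under translations, and pairing [g] with [- g] makes
    the positive and negative parts of each coordinate have equal integrals. *)
Lemma finite_polarizing (R : realType) (A : falgType R) (star : A -> A) (G : set A) :
  finite_set G -> is_subgroup star G -> generates star G -> G (- 1) ->
  is_polarizing star G.
Proof.
move=> finG subG genG GN1; have [subU G1 Gm _] := subG.
split=> //; first exact: finite_compact.
have mG := measurable_finite_set finG.
have [s [us Gs]] : exists s : seq A, uniq s /\ G = [set` s].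
  have [s ->] := (finite_seqP G).1 finG; exists (undup s); rewrite undup_uniq.
  by split=> //; apply/seteqP; split=> x /=; rewrite mem_undup.
have inG x : G x <-> x \in s by rewrite Gs.
have s0 : (0 < size s)%N by move/inG: G1; case: (s).
have sG : {in s, forall a, G a} by move=> a /inG.
have shift g : G g -> perm_eq [seq g * a | a <- s] s.
  move=> Gg; have gi : injective ( *%R g).
    move=> x y /(congr1 ( *%R (star g))).
    by rewrite !mulrA (mulr1_comm (subU _ Gg)) !mul1r.
  have um : uniq [seq g * a | a <- s] by rewrite map_inj_uniq.
  have sub : {subset [seq g * a | a <- s] <= s}.
    by move=> _ /mapP [a /inG Ga ->]; apply/inG; exact: Gm.
  have [|_ eqi] := uniq_min_size um sub; first by rewrite size_map.
  exact: uniq_perm.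
exists (counting_probability s0); split.
  split; first exact: counting_law_full.
  move=> g E Gg mE; rewrite /= !counting_lawE; congr (_ * _)%:E.
  by rewrite -[RHS](perm_big _ (shift g Gg)) big_map.
rewrite /vector_mean -[RHS](linear0 r2v); congr r2v; apply/rowP => i; rewrite !mxE.
pose f (x : borel_space A) := (coordinate i x)%:E.
have mf : measurable_fun (G : set (borel_space A)) f.
  apply/measurable_EFinP; apply: measurable_funS (coordinate_measurable i) => //.
suff : (\int[counting_law s]_(x in (G : set (borel_space A))) f x = 0)%E by rewrite /Rintegral => ->.
rewrite integralE !ge0_integral_counting_law //; last 2 first.
- exact: measurable_funeneg.
- exact: measurable_funepos.
have fN a : f (- a) = (- f a)%E by rewrite /f /coordinate linearN mxE EFinN.
have -> : (\sum_(a <- s) f^\- a = \sum_(a <- s) f^\+ a)%E.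
  rewrite -(perm_big _ (shift _ GN1)) big_map; apply: eq_bigr => a _.
  by rewrite mulN1r funenegE funeposE fN oppeK.
rewrite subee // fin_numM // sum_fin_num; apply/allP => _ /mapP [x _ ->].
by rewrite funeposE /f -EFin_max.
Qed.

(** * Polarizable involutions are definite *)

Section LeftRegular.
Variables (R : realType) (A : falgType R) (star : {linear A -> A}).
Hypothesis star_inv : is_involution star.

Let starM a b : star (a * b) = star b * star a. Proof. by case: star_inv. Qed.
Let starK a : star (star a) = a. Proof. by case: star_inv. Qed.

Definition lreg (a : A) : 'M[R]_(dim A) := lin1_mx (v2r \o amull a \o r2v).
Definition rreg (a : A) : 'M[R]_(dim A) := lin1_mx (v2r \o amulr a \o r2v).

Lemma mul_lreg x a : x *m lreg a = v2r (a * r2v x).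
Proof. by rewrite mul_rV_lin1 /= lfunE. Qed.

Lemma mul_rreg x a : x *m rreg a = v2r (r2v x * a).
Proof. by rewrite mul_rV_lin1 /= lfunE. Qed.

Lemma eq_row_action m n (X Y : 'M[R]_(m, n)) :
  (forall x : 'rV_m, x *m X = x *m Y) -> X = Y.
Proof. by move=> XY; apply/row_matrixP => i; rewrite !rowE XY. Qed.

Lemma lreg_linear : linear lreg.
Proof.
move=> k a b; apply: eq_row_action => x.
by rewrite mulmxDr -scalemxAr !mul_lreg mulrDl -scalerAl linearP.
Qed.

Lemma lreg1 : lreg 1 = 1%:M.
Proof. by apply: eq_row_action => x; rewrite mul_lreg mul1r r2vK mulmx1. Qed.

Lemma lregM a b : lreg a *m lreg b = lreg (b * a).
Proof.
by apply: eq_row_action => x; rewrite mulmxA !mul_lreg v2rK mulrA.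
Qed.

(** Each row of [lreg a] is the image of [a] under a fixed linear map, namely
    right multiplication by a basis vector. *)
Lemma frob2_lreg a :
  frob2 (lreg a) <= frob2 (v2r a) * \sum_i frob2 (rreg (r2v (delta_mx 0 i))).
Proof.
rewrite {1}/frob2 mulr_sumr; apply: ler_sum => i _.
apply: le_trans (frob2_mul _ _); rewrite mul_rreg v2rK -mul_lreg -rowE.
by rewrite /frob2 big_ord1 le_eqVlt; apply/orP; left; apply/eqP;
  apply: eq_bigr => j _; rewrite !mxE.
Qed.

Lemma compact_coordinates_bounded (G : set A) : compact_in G ->
  exists c : R, forall u, G u -> frob2 (v2r u) <= c.
Proof.
move=> cG.
have /choice [M MP] : forall i : 'I_(dim A), exists M : R,
    forall u, G u -> (coordinate i u) ^+ 2 <= M.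
  move=> i; have : compact ((coordinate i : natural_space A -> R) @` G).
    apply: (@continuous_compact (natural_space A) R (coordinate i) G _ cG).
    by apply: continuous_subspaceT; exact: coordinate_continuous.
  move=> /compact_bounded [M [Mr MP]]; exists ((`|M| + 1) ^+ 2) => u Gu.
  rewrite -[leLHS]real_normK ?num_real // ler_sqr ?nnegrE ?addr_ge0 //.
  apply: MP; last by exists u.
  by rewrite (le_lt_trans (ler_norm M)) // ltrDl.
exists (\sum_i M i) => u Gu; rewrite /frob2 big_ord1.
by apply: ler_sum => i _; exact: MP.
Qed.

(* It vanishes when lreg (star a) is the adjoint of lreg a for the form S. *)
Let adjoint_defect (S : 'M[R]_(dim A)) a := lreg a *m S - S *m (lreg (star a))^T.

Let adjoint_defect_linear S : linear (adjoint_defect S).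
Proof.
move=> k a b; rewrite /adjoint_defect [star _]linearP !lreg_linear.
rewrite linearP /= mulmxDl mulmxDr -scalemxAl -scalemxAr scalerBr opprD.
by rewrite addrACA.
Qed.

(** The unitary group acts on the algebra by left multiplication and is bounded,
    so it preserves a positive definite form [S].  Unitaries [u] therefore
    satisfy [S(u x, y) = S(x, u^* y)].  The elements [a] with
    [S(a x, y) = S(x, a^* y)] form a *-subalgebra, hence all of the algebra, and
    [S(a, a) = S(a^* a, 1)] gives definiteness. *)
Theorem polarizable_definite : is_polarizable star ->
  forall x y : A, star x * x + star y * y = 0 -> x = 0.
Proof.
move=> [cG gG].
have [c cP] := compact_coordinates_bounded cG.
have s1 := star1 star_inv.
have uG u : unitary_group star u -> star u * u = 1 by exact: mulr1_comm.
have [||||S [sS Spos Sinv]] :=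
  @invariant_form R _ (lreg @` unitary_group star)
    (c * \sum_i frob2 (rreg (r2v (delta_mx 0 i)))).
- by exists 1; rewrite ?lreg1 // /unitary_group /= s1 mulr1.
- move=> _ _ [u uu <-] [v vv <-]; exists (v * u); last by rewrite lregM.
  by rewrite /unitary_group /= starM -mulrA (mulrA u) uu mul1r.
- move=> _ [u uu <-]; exists (lreg (star u)); last by rewrite lregM uu lreg1.
  by exists (star u) => //; rewrite /unitary_group /= starK uG.
- move=> _ [u uu <-]; apply: le_trans (frob2_lreg u) _.
  by rewrite ler_wpM2r ?cP // sumr_ge0 // => i _; exact: frob2_ge0.
pose f := GRing.isLinear.Build R A 'M[R]_(dim A) _ (adjoint_defect S) (@adjoint_defect_linear S).
pose F : {linear A -> 'M[R]_(dim A)} := HB.pack (adjoint_defect S) f.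
have adj a : lreg a *m S = S *m (lreg (star a))^T.
  apply/eqP; rewrite -subr_eq0; suff : a \in lker (linfun F).
    by rewrite memv_ker lfunE.
  suff -> : lker (linfun F) = fullv by exact: memvf.
  have inF b : (b \in lker (linfun F)) = (lreg b *m S == S *m (lreg (star b))^T).
    by rewrite memv_ker lfunE /= subr_eq0.
  apply: gG => [|g gu].
    split.
    - by rewrite inF s1 lreg1 trmx1 mul1mx mulmx1.
    - move=> x y; rewrite !inF => /eqP xS /eqP yS.
      rewrite -lregM starM -lregM trmx_mul -mulmxA xS mulmxA yS.
      by rewrite mulmxA.
    - move=> x; rewrite !inF => /eqP xS; rewrite starK.
      by rewrite -{2}sS -trmx_mul xS trmx_mul trmxK sS.
  rewrite inF; apply/eqP; rewrite -{2}(Sinv (lreg g)); last by exists g.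
  by rewrite -!mulmxA -trmx_mul lregM gu lreg1 trmx1 mulmx1.
move=> x y xy.
pose q a := (v2r a *m S *m (v2r a)^T) 0 0.
have qE a : q a = (v2r (star a * a) *m S *m (v2r 1)^T) 0 0.
  have va : v2r a = v2r 1 *m lreg a by rewrite mul_lreg v2rK mulr1.
  have Sa : S *m (lreg a)^T = lreg (star a) *m S by rewrite adj starK.
  rewrite /q {2}va trmx_mul -(mulmxA _ S) (mulmxA S) Sa.
  by rewrite !mulmxA mul_lreg v2rK.
have q0 : q x + q y = 0.
  have := congr1 (fun a => (v2r a *m S *m (v2r 1)^T) 0 0) xy.
  by rewrite /= !qE linearD linear0 !mulmxDl !mul0mx !mxE.
apply: (can_inj v2rK); rewrite linear0; apply: frob2_eq0.
apply: le_trans (Spos _) _; rewrite -/(q x) -q0 lerDl.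
exact: le_trans (frob2_ge0 _) (Spos _).
Qed.

End LeftRegular.

Theorem proposition5p3 (R : realType) (A : falgType R)
  (star : {linear A -> A})
  (star_inv : is_involution star)
  (polA : is_polarizable star) :
  exists G : set A, finite_set G /\ is_polarizing star G.
Proof.
have [G [finG subG genG GN1]] :=
  finite_generating_group star_inv (polarizable_definite star_inv polA).
by exists G; split; last exact: finite_polarizing.
Qed.
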